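(* Let $d\in\mathbb{Z}_{>0}\cup\{\infty\}$, $x\in\mathbb{R}^{n_x}$ and $\varepsilon>0$, and let $\nu$ and $\mu$ be the homogeneity degrees of $f$ and of $(\ell,\jmath)$, respectively. If $\mathbf{u}_d^{\star}$ is an optimal sequence of inputs for the cost $J_{d,1,1}$ at $x$, then $$V_{d,\varepsilon^{-\mu},\nu}(\lambda^{r}(\varepsilon)x)=V_{d,1,1}(x),$$ and $\Lambda^{q}_{\nu,d}(\varepsilon)\mathbf{u}_d^{\star}$ is an optimal sequence of inputs for the cost $J_{d,\varepsilon^{-\mu},\nu}$ at $\lambda^{r}(\varepsilon)x$, i.e. $J_{d,\varepsilon^{-\mu},\nu}(\lambda^{r}(\varepsilon)x,\Lambda^{q}_{\nu,d}(\varepsilon)\mathbf{u}_d^{\star})=V_{d,\varepsilon^{-\mu},\nu}(\lambda^{r}(\varepsilon)x)$. Equivalently, $$V_{d,1,1}(\lambda^{r}(\varepsilon)x)=V_{d,\varepsilon^{\mu},\nu}(x),$$ and, if $\mathbf{u}_d^{\star}$ is an optimal sequence of inputs for the cost $J_{d,1,1}$ at $\lambda^{r}(\varepsilon)x$, then $\Lambda^{q}_{\nu,d}(\varepsilon^{-1})\mathbf{u}_d^{\star}$ is an optimal sequence of inputs for the cost $J_{d,\varepsilon^{\mu},\nu}$ at $x$, i.e. $J_{d,\varepsilon^{\mu},\nu}(x,\Lambda^{q}_{\nu,d}(\varepsilon^{-1})\mathbf{u}_d^{\star})=V_{d,\varepsilon^{\mu},\nu}(x)$.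
   Context: Notation. For $r=(r_1,\dots,r_n)$ with all $r_i>0$, the dilation map is $\lambda^r(\varepsilon)x:=(\varepsilon^{r_1}x_1,\dots,\varepsilon^{r_n}x_n)$ for $\varepsilon>0$, $x\in\mathbb{R}^n$; for a real exponent $s$, $\lambda^r(\varepsilon)^{s}:=\lambda^r(\varepsilon^{s})$. For $d\in\mathbb{Z}_{>0}\cup\{\infty\}$, a sequence of $d$ inputs is $\mathbf{u}_d=(u_0,\dots,u_{d-1})\in(\mathbb{R}^{n_u})^d$ (an infinite sequence if $d=\infty$), and for $c\in\mathbb{R}$, $\Lambda^{q}_{c,d}(\varepsilon)\mathbf{u}_d:=(\lambda^q(\varepsilon)u_0,\lambda^q(\varepsilon)^{c}u_1,\dots,\lambda^q(\varepsilon)^{c^{d-1}}u_{d-1})$, i.e. its $k$-th entry is $\lambda^q(\varepsilon)^{c^k}u_k$. System: $x^+=f(x,u)$ with $f=(f_1,\dots,f_{n_x}):\mathbb{R}^{n_x}\times\mathbb{R}^{n_u}\to\mathbb{R}^{n_x}$, $n_x,n_u\in\mathbb{Z}_{>0}$. $\phi(k,x,\mathbf{u}_d)$ is the solution at time $k$ (finite, $0\le k\le d$) from initial state $x$ with inputs $\mathbf{u}_d$: $\phi(0,x,\mathbf{u}_d)=x$, $\phi(k+1,x,\mathbf{u}_d)=f(\phi(k,x,\mathbf{u}_d),u_k)$. Cost: $\ell:\mathbb{R}^{n_x}\times\mathbb{R}^{n_u}\to[0,\infty]$ is the stage cost and $\jmath:\mathbb{R}^{n_x}\to[0,\infty]$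 the terminal cost ($\jmath$ is the zero function when $d=\infty$). For $\gamma_1>0$, $\gamma_2\in\mathbb{R}$, $$J_{d,\gamma_1,\gamma_2}(x,\mathbf{u}_d):=\sum_{k=0}^{d-1}\gamma_1^{\gamma_2^k}\ell(\phi(k,x,\mathbf{u}_d),u_k)+\gamma_1^{\gamma_2^d}\jmath(\phi(d,x,\mathbf{u}_d))$$ (the last term being absent if $d=\infty$), and $V_{d,\gamma_1,\gamma_2}(x):=\min_{\mathbf{u}_d}J_{d,\gamma_1,\gamma_2}(x,\mathbf{u}_d)$. A sequence attaining this minimum is called an optimal sequence of inputs for $J_{d,\gamma_1,\gamma_2}$ at $x$. Standing assumptions. (1) There are $\nu>0$, $r\in\mathbb{R}_{>0}^{n_x}$, $q\in\mathbb{R}_{>0}^{n_u}$ with $f(\lambda^r(\varepsilon)x,\lambda^q(\varepsilon)u)=\lambda^r(\varepsilon)^{\nu}f(x,u)$ (i.e. $f_i(\lambda^r(\varepsilon)x,\lambda^q(\varepsilon)u)=\varepsilon^{r_i\nu}f_i(x,u)$ for each $i$) for all $x\in\mathbb{R}^{n_x},u\in\mathbb{R}^{n_u},\varepsilon>0$. (2) There is $\mu\in\mathbb{R}$ with $\ell(\lambda^r(\varepsilon)x,\lambda^q(\varepsilon)u)=\varepsilon^{\mu}\ell(x,u)$ and $\jmath(\lambda^r(\varepsilon)x)=\varepsilon^{\mu}\jmath(x)$ for all $x,u$ and $\varepsilon>0$. (3) For all $d\in\mathbb{Z}_{>0}\cup\{\infty\}$, $\gamma_1>0$, $\gamma_2\in\mathbb{R}$,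 $x\in\mathbb{R}^{n_x}$, there is a $d$-length input sequence $\mathbf{u}_d^\star$ with $V_{d,\gamma_1,\gamma_2}(x)=J_{d,\gamma_1,\gamma_2}(x,\mathbf{u}_d^\star)<\infty$. *)

(* Defs.v *)
From HB Require Import structures.
From mathcomp Require Import all_boot all_order all_algebra.
From mathcomp Require Import all_classical all_reals all_analysis.

Set Implicit Arguments.
Unset Strict Implicit.
Unset Printing Implicit Defensive.

Import Order.TTheory GRing.Theory Num.Theory.

Local Open Scope classical_set_scope.
Local Open Scope ring_scope.

Definition dilation (R : realType) (n : nat) (r : 'rV[R]_n) (eps : R)
    (x : 'rV[R]_n) : 'rV[R]_n :=
  \row_i ((eps `^ r 0 i) * x 0 i).

(* lambda^r(eps)^s := lambda^r(eps^s) *)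
Definition dilation_pow (R : realType) (n : nat) (r : 'rV[R]_n) (eps s : R)
    (x : 'rV[R]_n) : 'rV[R]_n :=
  dilation r (eps `^ s) x.

(* [Some n] is the finite horizon n, [None] the infinite one. *)
Definition horizon := option nat.

Definition horizon_pos (d : horizon) : bool :=
  if d is Some n then (0 < n)%N else true.

Definition inputs (R : realType) (nu : nat) (d : horizon) : Type :=
  match d with
  | Some n => 'I_n -> 'rV[R]_nu
  | None => nat -> 'rV[R]_nu
  end.

(* The value 0 beyond a finite horizon is a placeholder: neither [phi k] with
   k <= d nor the cost [J] depends on it. *)
Definition input_at (R : realType) (nu : nat) (d : horizon) :
    inputs R nu d -> nat -> 'rV[R]_nu :=
  match d with
  | Some n => fun u k => if insub k is Some i then u i else 0
  | None => fun u k => u k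
  end.

Definition Lambda (R : realType) (nu : nat) (q : 'rV[R]_nu) (c : R)
    (d : horizon) (eps : R) : inputs R nu d -> inputs R nu d :=
  match d with
  | Some n => fun u i => dilation_pow q eps (c ^+ i) (u i)
  | None => fun u k => dilation_pow q eps (c ^+ k) (u k)
  end.

Fixpoint phi (R : realType) (nx nu : nat)
    (f : 'rV[R]_nx -> 'rV[R]_nu -> 'rV[R]_nx) (d : horizon)
    (k : nat) (x : 'rV[R]_nx) (u : inputs R nu d) : 'rV[R]_nx :=
  if k is k'.+1 then f (phi f k' x u) (input_at u k') else x.

Definition stage_term (R : realType) (nx nu : nat)
    (f : 'rV[R]_nx -> 'rV[R]_nu -> 'rV[R]_nx)
    (ell : 'rV[R]_nx -> 'rV[R]_nu -> \bar R)
    (d : horizon) (gamma1 gamma2 : R) (x : 'rV[R]_nx) (u : inputs R nu d)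
    (k : nat) : \bar R :=
  ((gamma1 `^ (gamma2 ^+ k))%:E * ell (phi f k x u) (input_at u k))%E.

Definition J (R : realType) (nx nu : nat)
    (f : 'rV[R]_nx -> 'rV[R]_nu -> 'rV[R]_nx)
    (ell : 'rV[R]_nx -> 'rV[R]_nu -> \bar R) (j : 'rV[R]_nx -> \bar R)
    (d : horizon) (gamma1 gamma2 : R) (x : 'rV[R]_nx) (u : inputs R nu d) :
    \bar R :=
  match d with
  | Some n =>
      (\sum_(0 <= k < n) stage_term f ell gamma1 gamma2 x u k
       + (gamma1 `^ (gamma2 ^+ n))%:E * j (phi f n x u))%E
  | None => (\sum_(0 <= k <oo) stage_term f ell gamma1 gamma2 x u k)%E
  end.

(* Written as an infimum, which is a minimum exactly when some u satisfies
   [optimal_inputs]; attainment is a hypothesis wherever V is used. *)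
Definition V (R : realType) (nx nu : nat)
    (f : 'rV[R]_nx -> 'rV[R]_nu -> 'rV[R]_nx)
    (ell : 'rV[R]_nx -> 'rV[R]_nu -> \bar R) (j : 'rV[R]_nx -> \bar R)
    (d : horizon) (gamma1 gamma2 : R) (x : 'rV[R]_nx) : \bar R :=
  ereal_inf (range (fun u : inputs R nu d => J f ell j gamma1 gamma2 x u)).

Definition optimal_inputs (R : realType) (nx nu : nat)
    (f : 'rV[R]_nx -> 'rV[R]_nu -> 'rV[R]_nx)
    (ell : 'rV[R]_nx -> 'rV[R]_nu -> \bar R) (j : 'rV[R]_nx -> \bar R)
    (d : horizon) (gamma1 gamma2 : R) (x : 'rV[R]_nx) (u : inputs R nu d) :
    Prop :=
  J f ell j gamma1 gamma2 x u = V f ell j d gamma1 gamma2 x.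

(* Main.v *)
Require Import Defs.
From HB Require Import structures.
From mathcomp Require Import all_boot all_order all_algebra.
From mathcomp Require Import all_classical all_reals all_analysis.

Set Implicit Arguments.
Unset Strict Implicit.
Unset Printing Implicit Defensive.

Import Order.TTheory GRing.Theory Num.Theory.
Local Open Scope ring_scope.

(* The scaling u |-> Lambda u is a bijection of the input sequences that turns
   the solution from x at time k into the solution from lambda(eps) x, dilated by
   eps^(nu^k).  Hence each stage cost is multiplied by eps^(mu nu^k), which the
   weight (eps^-mu)^(nu^k) cancels: the two costs are equal, and so are their
   infima.  The second half is the first one for 1/eps at lambda(eps) x. *)

Section Dilation.
Variables (R : realType) (n : nat) (r : 'rV[R]_n).

Lemma dilation1 (x : 'rV[R]_n) : dilation r 1 x = x.
Proof. by apply/rowP => i; rewrite mxE powR1 mul1r. Qed.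

Lemma dilation0 (eps : R) : dilation r eps 0 = 0.
Proof. by apply/rowP => i; rewrite !mxE mulr0. Qed.

Lemma dilationM (a b : R) (x : 'rV[R]_n) : 0 <= a -> 0 <= b ->
  dilation r a (dilation r b x) = dilation r (a * b) x.
Proof.
by move=> a0 b0; apply/rowP => i; rewrite !mxE mulrA -powRM.
Qed.

Lemma dilationVK (eps : R) : 0 < eps ->
  cancel (dilation r eps) (dilation r eps^-1).
Proof.
move=> e0 x.
by rewrite dilationM ?invr_ge0 ?(ltW e0)// mulVf ?gt_eqF// dilation1.
Qed.

(** The factors [eps^-1] and [eps] may be raised to the power [s] before or after being multiplied,
    and [1] to any power is [1]. *)
Lemma dilation_powVK (eps s : R) : 0 < eps ->
  cancel (dilation_pow r eps^-1 s) (dilation_pow r eps s).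
Proof.
move=> e0 x; rewrite /dilation_pow dilationM ?powR_ge0// -powRM ?invr_ge0 ?ltW//.
by rewrite mulfV ?gt_eqF// powR1 dilation1.
Qed.

End Dilation.

(** No bound on [k] is required: past a finite horizon both sides are the placeholder 0, which every
    dilation fixes. *)
Lemma input_at_Lambda (R : realType) (nu : nat) (q : 'rV[R]_nu) (c : R)
    (d : horizon) (eps : R) (u : inputs R nu d) (k : nat) :
  input_at (Lambda q c eps u) k = dilation_pow q eps (c ^+ k) (input_at u k).
Proof.
case: d u => [n|] u //=.
by case: insubP => [i _ <-|_] //; rewrite /dilation_pow dilation0.
Qed.

(** Provides the preimages under the scaling when the two sets of attained costs are compared. *)
Lemma LambdaVK (R : realType) (nu : nat) (q : 'rV[R]_nu) (c : R)
    (d : horizon) (eps : R) : 0 < eps ->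
  cancel (@Lambda R nu q c d eps^-1) (Lambda q c eps).
Proof. by case: d => [n|] e0 u; apply/funext => k /=; rewrite dilation_powVK. Qed.

Section Scaling.
Variables (R : realType) (nx nu : nat).
Variables (f : 'rV[R]_nx -> 'rV[R]_nu -> 'rV[R]_nx).
Variables (ell : 'rV[R]_nx -> 'rV[R]_nu -> \bar R) (j : 'rV[R]_nx -> \bar R).
Variables (deg_f mu : R) (r : 'rV[R]_nx) (q : 'rV[R]_nu).
Hypothesis f_hom : forall x u (eps : R), 0 < eps ->
  f (dilation r eps x) (dilation q eps u) = dilation_pow r eps deg_f (f x u).
Hypothesis ell_hom : forall x u (eps : R), 0 < eps ->
  ell (dilation r eps x) (dilation q eps u) = ((eps `^ mu)%:E * ell x u)%E.
Hypothesis j_hom : forall x (eps : R), 0 < eps ->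
  j (dilation r eps x) = ((eps `^ mu)%:E * j x)%E.

Variables (d : horizon) (eps : R).
Hypothesis eps_gt0 : 0 < eps.

Lemma phi_Lambda (x : 'rV[R]_nx) (u : inputs R nu d) (k : nat) :
  phi f k (dilation r eps x) (Lambda q deg_f eps u) =
  dilation_pow r eps (deg_f ^+ k) (phi f k x u).
Proof.
elim: k => [|k IHk] /=; first by rewrite /dilation_pow expr0 powRr1 ?ltW.
by rewrite IHk input_at_Lambda f_hom ?powR_gt0// /dilation_pow -powRrM -exprSr.
Qed.

(** The exponents [- mu * s] and [s * mu] add up to 0. The two real factors are merged into 1 before
    they meet [a], so infinite values are covered. It is applied with [s] a power of [deg_f]. *)
Lemma weight_cancel (s : R) (a : \bar R) :
  (((eps `^ (- mu)) `^ s)%:E * (((eps `^ s) `^ mu)%:E * a) = a)%E.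
Proof.
(* Adding exponents whose sum may vanish requires a nonzero base. *)
rewrite muleA -EFinM -!powRrM -powRD; last by rewrite (gt_eqF eps_gt0) implybT.
by rewrite mulNr [s * mu]mulrC addNr powRr0 mul1e.
Qed.

Lemma J_Lambda (x : 'rV[R]_nx) (u : inputs R nu d) :
  J f ell j (eps `^ (- mu)) deg_f (dilation r eps x) (Lambda q deg_f eps u) =
  J f ell j 1 1 x u.
Proof.
have stageE k : stage_term f ell (eps `^ (- mu)) deg_f (dilation r eps x)
    (Lambda q deg_f eps u) k = stage_term f ell 1 1 x u k.
  rewrite /stage_term phi_Lambda input_at_Lambda ell_hom ?powR_gt0//.
  by rewrite weight_cancel powR1 mul1e.
have terminalE n : (((eps `^ (- mu)) `^ (deg_f ^+ n))%:E *
    j (phi f n (dilation r eps x) (Lambda q deg_f eps u)) =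
    (1 `^ (1 ^+ n))%:E * j (phi f n x u))%E.
  by rewrite phi_Lambda j_hom ?powR_gt0// weight_cancel powR1 mul1e.
(* Termwise equality settles both horizons: the infinite series agree because their terms do, with
   no question of convergence. *)
case: d u stageE terminalE => [n|] u stageE terminalE; rewrite /J.
  by rewrite terminalE; congr (_ + _)%E; apply: eq_bigr.
by apply: eq_eseriesr.
Qed.

Lemma V_dilation (x : 'rV[R]_nx) :
  V f ell j d (eps `^ (- mu)) deg_f (dilation r eps x) = V f ell j d 1 1 x.
Proof.
rewrite /V; congr ereal_inf; apply/seteqP; split=> _ [u _ <-].
  (* A cost attained at the dilated state comes from the input scaled back by [eps^-1]. *)
  exists (Lambda q deg_f eps^-1 u) => //.
  by rewrite -J_Lambda LambdaVK.
by exists (Lambda q deg_f eps u) => //; rewrite J_Lambda.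
Qed.

Lemma optimal_Lambda (x : 'rV[R]_nx) (u : inputs R nu d) :
  optimal_inputs f ell j 1 1 x u ->
  optimal_inputs f ell j (eps `^ (- mu)) deg_f (dilation r eps x)
    (Lambda q deg_f eps u).
Proof. by rewrite /optimal_inputs J_Lambda V_dilation. Qed.

End Scaling.

Theorem theorem1 (R : realType) (nx nu : nat)
    (nx_gt0 : (0 < nx)%N) (nu_gt0 : (0 < nu)%N)
    (f : 'rV[R]_nx -> 'rV[R]_nu -> 'rV[R]_nx)
    (ell : 'rV[R]_nx -> 'rV[R]_nu -> \bar R) (j : 'rV[R]_nx -> \bar R)
    (ell_ge0 : forall x u, (0 <= ell x u)%E)
    (j_ge0 : forall x, (0 <= j x)%E)
    (deg_f : R) (r : 'rV[R]_nx) (q : 'rV[R]_nu)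
    (deg_f_gt0 : 0 < deg_f)
    (r_gt0 : forall i, 0 < r 0 i) (q_gt0 : forall i, 0 < q 0 i)
    (f_hom : forall x u (eps : R), 0 < eps ->
       f (dilation r eps x) (dilation q eps u) = dilation_pow r eps deg_f (f x u))
    (mu : R)
    (ell_hom : forall x u (eps : R), 0 < eps ->
       ell (dilation r eps x) (dilation q eps u) = ((eps `^ mu)%:E * ell x u)%E)
    (j_hom : forall x (eps : R), 0 < eps ->
       j (dilation r eps x) = ((eps `^ mu)%:E * j x)%E)
    (optimal_exists : forall (d : horizon) (gamma1 gamma2 : R) (x : 'rV[R]_nx),
       horizon_pos d -> 0 < gamma1 ->
       exists u : inputs R nu d,
         V f ell j d gamma1 gamma2 x = J f ell j gamma1 gamma2 x u /\
         (J f ell j gamma1 gamma2 x u < +oo)%E)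
    (d : horizon) (d_pos : horizon_pos d)
    (x : 'rV[R]_nx) (eps : R) (eps_gt0 : 0 < eps) :
  (forall ustar : inputs R nu d,
     optimal_inputs f ell j 1 1 x ustar ->
     V f ell j d (eps `^ (- mu)) deg_f (dilation r eps x) =
       V f ell j d 1 1 x /\
     optimal_inputs f ell j (eps `^ (- mu)) deg_f (dilation r eps x)
       (Lambda q deg_f eps ustar)) /\
  (V f ell j d 1 1 (dilation r eps x) = V f ell j d (eps `^ mu) deg_f x /\
   forall ustar : inputs R nu d,
     optimal_inputs f ell j 1 1 (dilation r eps x) ustar ->
     optimal_inputs f ell j (eps `^ mu) deg_f x
       (Lambda q deg_f eps^-1 ustar)).
Proof.
split=> [ustar opt_u|].
  (* The equality of values does not mention [q], which is therefore given explicitly. *)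
  split; first exact: (V_dilation (q := q)).
  exact: optimal_Lambda.
have epsV_gt0 : 0 < eps^-1 by rewrite invr_gt0.
have xE : dilation r eps^-1 (dilation r eps x) = x by exact: dilationVK.
(* Inverting [eps] turns the weight of the first half into that of the second. *)
have muE : eps^-1 `^ (- mu) = eps `^ mu.
  by rewrite -powR_inv1 ?ltW// -powRrM mulrNN mul1r.
have := V_dilation f_hom ell_hom j_hom d epsV_gt0 (dilation r eps x).
have := @optimal_Lambda _ _ _ _ _ _ _ _ _ _ f_hom ell_hom j_hom d _ epsV_gt0
  (dilation r eps x).
by rewrite xE muE => opt_Lambda ->.
Qed.
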